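(* Let $\mathscr X$ be a Banach space, $\mathscr Y$ a Hilbert space and $A:\mathscr X\to\mathscr Y$ a bounded linear operator with adjoint $A^*$. Let $\mathcal R:\mathscr X\to[0,\infty]$ be proper, lower semi-continuous and $c_0$-strongly convex for some $c_0>0$, assume $Ax=y$ has a solution in $\mathrm{dom}(\mathcal R)$, and let $x^\dagger$ be its unique $\mathcal R$-minimizing solution. Let $y_1,y_2,\dots$ be independent identically distributed $\mathscr Y$-valued random variables with $\mathbb E[y_1]=y$ and $0<\sigma^2:=\mathbb E[\|y_1-y\|^2]<\infty$, and $\bar y^{(n)}=\frac1n\sum_{i=1}^n y_i$. For $n\ge1$ define, with $\lambda_0^{(n)}=0$, $$x_t^{(n)}=\arg\min_{x\in\mathscr X}\{\mathcal R(x)-\langle\lambda_t^{(n)},Ax\rangle\},\qquad \lambda_{t+1}^{(n)}=\lambda_t^{(n)}-\gamma(Ax_t^{(n)}-\bar y^{(n)}),$$ with $0<\gamma<4c_0/\|A\|^2$. If the integers $t_n$ satisfy $t_n\to\infty$ and $t_n/n\to0$ as $n\to\infty$, then $$\mathbb E\Big[D_{\mathcal R}^{A^*\lambda_{t_n}^{(n)}}(x^\dagger,x_{t_n}^{(n)})\Big]\to0\quad\text{and hence}\quad\mathbb E\big[\|x_{t_n}^{(n)}-x^\dagger\|^2\big]\to0\qquad\text{as }n\to\infty.$$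
   Context: A proper function $f$ is $c_0$-strongly convex if $f(s\bar x+(1-s)x)+c_0s(1-s)\|\bar x-x\|^2\le sf(\bar x)+(1-s)f(x)$ for all $\bar x,x\in\mathrm{dom}(f)$, $s\in[0,1]$. The $\mathcal R$-minimizing solution $x^\dagger$ satisfies $Ax^\dagger=y$ and $\mathcal R(x^\dagger)=\min\{\mathcal R(x):Ax=y\}$. For $\xi\in\partial\mathcal R(x)$, $D_{\mathcal R}^\xi(\bar x,x)=\mathcal R(\bar x)-\mathcal R(x)-\langle\xi,\bar x-x\rangle$; one has $A^*\lambda_t^{(n)}\in\partial\mathcal R(x_t^{(n)})$. *)

(* Defs.v *)
From HB Require Import structures.
From mathcomp Require Import all_boot all_order all_algebra.
From mathcomp Require Import all_classical all_reals all_analysis.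
Set Implicit Arguments. Unset Strict Implicit. Unset Printing Implicit Defensive.
Import Order.TTheory GRing.Theory Num.Theory.
Import numFieldNormedType.Exports.
Local Open Scope classical_set_scope.
Local Open Scope ring_scope.

Section defs.
Context {R : realType}.

(* ip is an inner product on the normed space Y inducing its norm;
   together with completeness of Y this makes Y a Hilbert space. *)
Definition is_inner_product (Y : normedModType R) (ip : Y -> Y -> R) : Prop :=
  [/\ (forall u v, ip u v = ip v u),
      (forall (a : R) u v w, ip (a *: u + v) w = a * ip u w + ip v w)
    & (forall u, `|u| ^+ 2 = ip u u)].

Definition bounded_op (X Y : normedModType R) (A : X -> Y) : Prop :=
  exists C : R, forall x, `|A x| <= C * `|x|.

Definition opnorm (X Y : normedModType R) (A : X -> Y) : R :=
  sup [set `|A x| | x in [set x : X | `|x| <= 1]].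

Definition dom (X : Type) (f : X -> \bar R) : set X := [set x | (f x < +oo)%E].

Definition proper_fun (X : Type) (f : X -> \bar R) : Prop :=
  (exists x, (f x < +oo)%E) /\ (forall x, (-oo < f x)%E).

Definition strongly_convex (X : normedModType R) (c0 : R) (f : X -> \bar R) : Prop :=
  forall xb x (s : R), dom f xb -> dom f x -> 0 <= s <= 1 ->
    (f (s *: xb + (1 - s) *: x)%R + (c0 * s * (1 - s) * `|xb - x| ^+ 2)%:E
      <= s%:E * f xb + (1 - s)%:E * f x)%E.

(* Bregman distance D_f^{A^* lam}(xb, x) = f xb - f x - <A^* lam, xb - x>
   with <A^* lam, z> = <lam, A z>_Y *)
Definition bregman (X Y : normedModType R) (ip : Y -> Y -> R) (A : X -> Y)
  (f : X -> \bar R) (lam : Y) (xb x : X) : \bar R :=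
  (f xb - f x - (ip lam (A (xb - x)%R))%:E)%E.

Definition borel_set (Y : topologicalType) : set (set Y) := <<s open >>.

Section prob.
Context {d : measure_display} {Omega : measurableType d}.

Definition borel_measurable_fun (Y : topologicalType) (f : Omega -> Y) : Prop :=
  forall B, borel_set B -> measurable (f @^-1` B).

Definition strongly_measurable (Y : normedModType R) (f : Omega -> Y) : Prop :=
  exists s : nat -> Omega -> Y,
    (forall k, finite_set (range (s k)) /\
               (forall v : Y, measurable (s k @^-1` [set v]))) /\
    (forall w, s k w @[k --> \oo] --> f w).

Definition mutually_independent (Y : topologicalType)
  (P : probability Omega R) (ys : nat -> Omega -> Y) : Prop :=
  forall (I : seq nat) (B : nat -> set Y), uniq I ->
    (forall i, i \in I -> borel_set (B i)) ->
    P (\big[setI/setT]_(i <- I) (ys i @^-1` B i)) =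
    (\prod_(i <- I) P (ys i @^-1` B i))%E.

Definition identically_distributed (Y : topologicalType)
  (P : probability Omega R) (ys : nat -> Omega -> Y) : Prop :=
  forall i B, borel_set B -> P (ys i @^-1` B) = P (ys 0%N @^-1` B).

End prob.
End defs.

(* Main.v *)
Require Import Defs.
From HB Require Import structures.
From mathcomp Require Import all_boot all_order all_algebra.
From mathcomp Require Import all_classical all_reals all_analysis.
From mathcomp Require Import measurable_realfun ring lra.
Import Order.TTheory GRing.Theory Num.Theory.
Import numFieldNormedType.Exports.
Local Open Scope classical_set_scope.
Local Open Scope ring_scope.

(* The Bregman distance at time [t] is the dual objective
   [g l = R xdag + R^* (A^* l) - <l, y>] evaluated at [lam t], and the iteration is
   exact gradient descent for the perturbed objective [g - <., e>], where
   [e = ybar - y]. The conjugate of a [c0]-strongly convex function is smooth, so a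
   step below [4 c0 / |A|^2] gives, with [S] of order [gamma * t] and for any [l],
     [g (lam t) - <lam t, e> <= g l - <l, e> + (|l|^2 - |lam t - l|^2 + O(1)) / S].
   The term [- |lam t - l|^2 / S] absorbs [<lam t - l, e>] by Young's inequality,
   leaving [g l + O(1 / S) + S |e|^2]. Since [E |e|^2 = sigma^2 / n], the limit of the
   expectations is at most [g l] for every [l], and [inf g = 0] by strong duality. *)

(** * Inner products and bounded operators *)

Section inner_product.
Context {R : realType} {Y : normedModType R} {ip : Y -> Y -> R}.
Hypothesis ipP : is_inner_product ip.

Lemma ipC u v : ip u v = ip v u.
Proof. by case: ipP. Qed.

Lemma ipDl u v w : ip (u + v) w = ip u w + ip v w.
Proof. by case: ipP => _ /(_ 1 u v w); rewrite scale1r mul1r. Qed.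

Lemma ip0l w : ip 0 w = 0.
Proof. by have := ipDl 0 0 w; rewrite addr0 => ?; lra. Qed.

Lemma ipZl a u w : ip (a *: u) w = a * ip u w.
Proof. by case: ipP => _ /(_ a u 0 w); rewrite addr0 ip0l addr0. Qed.

Lemma ipNl u w : ip (- u) w = - ip u w.
Proof. by rewrite -scaleN1r ipZl mulN1r. Qed.

Lemma ipBl u v w : ip (u - v) w = ip u w - ip v w.
Proof. by rewrite ipDl ipNl. Qed.

Lemma ipDr u v w : ip w (u + v) = ip w u + ip w v.
Proof. by rewrite ipC ipDl !(ipC w). Qed.

Lemma ipZr a u w : ip w (a *: u) = a * ip w u.
Proof. by rewrite ipC ipZl (ipC w). Qed.

Lemma ipBr u v w : ip w (u - v) = ip w u - ip w v.
Proof. by rewrite ipC ipBl !(ipC w). Qed.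

Lemma ip0r w : ip w 0 = 0.
Proof. by rewrite ipC ip0l. Qed.

Lemma ip_sqnorm u : ip u u = `|u| ^+ 2.
Proof. by case: ipP => _ _ ->. Qed.

Lemma sqnormD u v : `|u + v| ^+ 2 = `|u| ^+ 2 + 2 * ip u v + `|v| ^+ 2.
Proof. by rewrite -!ip_sqnorm ipDl !ipDr (ipC v u); ring. Qed.

Lemma sqnormB u v : `|u - v| ^+ 2 = `|u| ^+ 2 - 2 * ip u v + `|v| ^+ 2.
Proof. by rewrite -!ip_sqnorm ipBl !ipBr (ipC v u); ring. Qed.

(** Expanding the squared norm of u - (s/2) v gives this. The factor [s] is kept free so that the
    time-dependent weight of the energy estimate can be inserted. *)
Lemma ip_young u v (s : R) : s * ip u v <= `|u| ^+ 2 + s ^+ 2 * `|v| ^+ 2 / 4.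
Proof.
have := sqr_ge0 `|u - (s / 2) *: v|.
by rewrite sqnormB ipZr normrZ exprMn real_normK ?num_real// => ?; lra.
Qed.

(** Cauchy-Schwarz, from expanding the squared norm of |v| u - |u| v. *)
Lemma le_ip u v : ip u v <= `|u| * `|v|.
Proof.
have [->|v0] := eqVneq v 0; first by rewrite ip0r normr0 mulr0.
have v_gt0 : 0 < `|v| by rewrite normr_gt0.
rewrite -(ler_pM2l v_gt0).
have := sqr_ge0 `| `|v| *: u - `|u| *: v|.
rewrite sqnormB ipZr ipZl !normrZ !normr_id !exprMn => h.
have [->|u0] := eqVneq u 0; first by rewrite ip0l normr0; lra.
have u_gt0 : 0 < `|u| by rewrite normr_gt0.
rewrite -(ler_pM2l u_gt0); nra.
Qed.

Lemma norm_ip u v : `|ip u v| <= `|u| * `|v|.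
Proof. by rewrite ler_norml le_ip andbT lerNl -ipNl (le_trans (le_ip _ _))// normrN. Qed.

Lemma continuous_ip u : continuous (ip u).
Proof.
move=> v; apply/cvgrPdist_lt => e e0; near=> w.
rewrite -ipBr (le_lt_trans (norm_ip _ _))//.
rewrite (@le_lt_trans _ _ ((`|u| + 1) * `|v - w|))//.
  by rewrite ler_wpM2r// lerDl.
rewrite mulrC -ltr_pdivlMr ?ltr_wpDl//; near: w.
by apply: cvgr_dist_lt; rewrite ?divr_gt0 ?ltr_wpDl.
Unshelve. all: by end_near. Qed.

End inner_product.

Lemma norm_le_opnorm (R : realType) (X Y : normedModType R) (A : {linear X -> Y}) x :
  bounded_op A -> `|A x| <= opnorm A * `|x|.
Proof.
move=> [C AC].
have [->|x0] := eqVneq x 0; first by rewrite linear0 !normr0 mulr0.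
have nx : 0 < `|x| by rewrite normr_gt0.
rewrite -ler_pdivrMr//; apply: ub_le_sup.
  (* The absolute value is taken because [C] may be negative when the space is trivial. *)
  exists `|C| => _ [z /= z1 <-]; rewrite (le_trans (AC z))//.
  by rewrite (le_trans (ler_wpM2r _ (ler_norm C)))// ler_piMr.
exists (`|x|^-1 *: x) => /=.
  by rewrite normrZ normfV normr_id mulVf ?gt_eqF.
by rewrite linearZ/= normrZ normfV normr_id mulrC.
Qed.

Lemma opnorm_ge0 (R : realType) (X Y : normedModType R) (A : {linear X -> Y}) :
  bounded_op A -> 0 <= opnorm A.
Proof.
move=> [C AC]; apply: ub_le_sup; last by exists 0; rewrite /= ?linear0 ?normr0.
exists `|C| => _ [z /= z1 <-]; rewrite (le_trans (AC z))//.
by rewrite (le_trans (ler_wpM2r _ (ler_norm C)))// ler_piMr.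
Qed.

(* Minimizing sequences of the increasing functions [F k] form, along the
   diagonal, a Cauchy sequence: the midpoint of [u k] and [u l] is a competitor
   for [F k]. *)
Lemma strongly_convex_diagonal_min (R : realType) (X : completeNormedModType R)
    (D : set X) (F : nat -> X -> R) (c V : R) :
  0 < c -> D !=set0 ->
  (forall k u v, D u -> D v -> exists2 m, D m &
     F k m + c * `|u - v| ^+ 2 <= (F k u + F k v) / 2) ->
  (forall k u, D u -> 0 <= F k u) ->
  (forall k u, D u -> F k u <= F k.+1 u) ->
  (forall k (u : nat -> X) x a, u @ \oo --> x -> (forall l, D (u l)) ->
     (\forall l \near \oo, F k (u l) <= a) -> D x /\ F k x <= a) ->
  (forall k, inf (F k @` D) <= V) ->
  exists2 x, D x & forall k, F k x <= V.
Proof.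
move=> c0 [z0 Dz0] mid F0 Fincr Flsc FV.
pose v k := inf (F k @` D).
have lbF k : has_lbound (F k @` D) by exists 0 => _ [z Dz <-]; exact: F0.
have infF k : has_inf (F k @` D) by split => //; exists (F k z0), z0.
have Fmono k l z : D z -> (k <= l)%N -> F k z <= F l z.
  move=> Dz; elim: l => [|l ih]; first by rewrite leqn0 => /eqP ->.
  rewrite leq_eqVlt => /predU1P[-> //|]; rewrite ltnS => /ih/le_trans; apply.
  exact: Fincr.
have vF k z : D z -> v k <= F k z by move=> Dz; apply: ge_inf => //; exists z.
have vmono : nondecreasing_seq v.
  move=> k l kl; apply: lb_le_inf; first by exists (F l z0), z0.
  by move=> _ [z Dz <-]; rewrite (le_trans (vF k z Dz))// Fmono.
have ubv : has_ubound (range v) by exists V => _ [k _ <-]; exact: FV.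
have vcvg := nondecreasing_cvgn vmono ubv.
set W := sup _ in vcvg.
have vW k : v k <= W by apply: ub_le_sup => //; exists k.
have /choice[u uP] : forall k, exists z, D z /\ F k z < v k + k.+1%:R^-1.
  move=> k.
  have k0 : 0 < k.+1%:R^-1 :> R by rewrite invr_gt0.
  by have [_ [z Dz <-] ?] := inf_adherent k0 (infF k); exists z.
have Du k : D (u k) by case: (uP k).
(* The point [u l] is nearly optimal for [F l], so [F k (u l)] is below [W] plus 1/(k+1), while the
   midpoint costs at least [v k]. *)
have gap k l : (k <= l)%N -> c * `|u k - u l| ^+ 2 <= (W - v k) / 2 + k.+1%:R^-1.
  move=> kl.
  have [m Dm] := mid k _ _ (Du k) (Du l).
  have := vF k m Dm; have := (uP k).2; have := (uP l).2.
  have := Fmono k l _ (Du l) kl; have := vW l.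
  have : l.+1%:R^-1 <= k.+1%:R^-1 :> R by rewrite lef_pV2 ?posrE// ler_nat.
  move: (k.+1%:R^-1) (l.+1%:R^-1) => ek el; move=> *; lra.
have gap0 : (fun k => (W - v k) / 2 + k.+1%:R^-1) @ \oo --> (0 : R).
  rewrite [X in _ --> X](_ : _ = (W - W) / 2 + 0); last by rewrite subrr mul0r addr0.
  apply: cvgD; last exact: cvg_harmonic.
  by apply: cvgMl; apply: cvgB => //; exact: cvg_cst.
have ucvg : cvg (u @ \oo).
  apply/cauchy_cvgP/cauchy_exP => e e0.
  have ce : 0 < c * e ^+ 2 by rewrite mulr_gt0 ?exprn_gt0.
  have [N _ /(_ N (leqnn N)) gN] := cvgr_lt _ gap0 _ ce.
  exists (u N), N => // l /= Nl; rewrite -ball_normE /=.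
  have := le_lt_trans (gap N l Nl) gN.
  rewrite ltr_pM2l// ltNge => /negP h; rewrite ltNge; apply/negP => ee; apply: h.
  by rewrite lerXn2r ?nnegrE// ltW.
(* For large [l], [F k (u l) <= F l (u l)] is at most [V + e]; the closedness hypothesis carries
   this to the limit, which is the same point for every [k]. *)
have xP k e : 0 < e -> D (lim (u @ \oo)) /\ F k (lim (u @ \oo)) <= V + e.
  move=> e0; apply: (Flsc k _ _ _ ucvg Du).
  near=> l.
  rewrite (le_trans (Fmono k l _ (Du l) _))//; first by near: l; exists k.
  rewrite (le_trans (ltW (uP l).2))// lerD ?FV//.
  near: l; exact: (cvgr_le _ (@cvg_harmonic R)).
exists (lim (u @ \oo)) => [|k]; first by have [] := xP 0%N 1 ltr01.
by apply/ler_addgt0Pr => e e0; have [] := xP k e e0.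
Unshelve. all: by end_near. Qed.

(** * Strong duality and dual gradient descent *)

(** Letting [s] tend to 0 discards the higher-order term: this turns a comparison along a segment,
    divided by [s], into a first-order inequality. *)
Lemma ge0_of_affine_ge0 (R : realType) (a b : R) :
  (forall s, 0 < s <= 1 -> 0 <= a + s * b) -> 0 <= a.
Proof.
move=> h; apply/ler_addgt0Pr => e e0.
have [b0|b0] := leP b 0.
  by have := h 1 ltac:(by rewrite ltr01 lexx); rewrite mul1r => ?; lra.
(* This choice of [s] makes [s * b] at most [e]. *)
have := h (Num.min 1 (e / b)).
rewrite lt_min ltr01 divr_gt0// ge_min lexx /= => /(_ isT) h1.
rewrite (le_trans h1)// lerD2l -ler_pdivlMr// ge_min lexx orbT.
by [].
Qed.

Section deterministic.
Context {R : realType} {X Y : completeNormedModType R} {ip : Y -> Y -> R}.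
Context {A : {linear X -> Y}} {D : set X} {r : X -> R} {c0 : R}.
Hypothesis ipP : is_inner_product ip.
Hypothesis A_bounded : bounded_op A.
Hypothesis c0_gt0 : 0 < c0.
Hypothesis r_ge0 : forall z, D z -> 0 <= r z.
Hypothesis r_convex : forall u v (s : R), D u -> D v -> 0 <= s <= 1 ->
  D (s *: u + (1 - s) *: v) /\
  r (s *: u + (1 - s) *: v) + c0 * s * (1 - s) * `|u - v| ^+ 2
    <= s * r u + (1 - s) * r v.
(** Lower semi-continuity of an extended-valued functional, restated for its finite part [r] on its
    domain [D]: bounded values keep the limit in [D]. *)
Hypothesis r_lsc : forall (u : nat -> X) x a, u @ \oo --> x ->
  (forall l, D (u l)) -> (\forall l \near \oo, r (u l) <= a) -> D x /\ r x <= a.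

Lemma continuous_bounded_op : continuous A.
Proof.
have A1 : 0 < opnorm A + 1 by rewrite ltr_wpDl// opnorm_ge0.
move=> x; apply/cvgrPdist_lt => e e0; near=> z.
rewrite -linearB (le_lt_trans (norm_le_opnorm _ _ _ _ _ A_bounded))//.
rewrite (@le_lt_trans _ _ ((opnorm A + 1) * `|x - z|))//.
  by rewrite ler_wpM2r// lerDl.
rewrite mulrC -ltr_pdivlMr//; near: z.
by apply: cvgr_dist_lt; rewrite ?divr_gt0.
Unshelve. all: by end_near. Qed.

Lemma affine_comb_opB (y : Y) s u v :
  A (s *: u + (1 - s) *: v) - y = s *: (A u - y) + (1 - s) *: (A v - y).
Proof.
rewrite linearD !linearZ/= !scalerBr addrACA -opprD -scalerDl.
by rewrite [s + _]addrC subrK scale1r.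
Qed.

(** Serves twice: a constant weight yields an actual minimizer of one penalized problem, and the
    weights [k] yield a single point whose penalized values are all bounded by [V], hence a solution
    of the equation. *)
Lemma penalized_min (y : Y) (w : nat -> R) (V : R) : D !=set0 ->
  (forall k, 0 <= w k <= w k.+1) ->
  (forall k, inf [set r z + w k * `|A z - y| ^+ 2 | z in D] <= V) ->
  exists2 x, D x & forall k, r x + w k * `|A x - y| ^+ 2 <= V.
Proof.
move=> D0 w0.
pose F k z := r z + w k * `|A z - y| ^+ 2.
apply: (@strongly_convex_diagonal_min _ _ _ F (c0 / 4)) => //.
- by rewrite divr_gt0.
- move=> k u v Du Dv.
  (* Strong convexity at [s = 1/2] gives the modulus [c0 / 4]; the penalty is convex by the
     parallelogram identity. *)
  have h2 : 0 <= (2^-1 : R) <= 1 by rewrite invr_ge0 ler0n invf_le1 ?ler1n.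
  have [Dm rm] := r_convex _ _ _ Du Dv h2; exists (2^-1 *: u + (1 - 2^-1) *: v) => //.
  rewrite /F affine_comb_opB.
  have half : 1 - 2^-1 = 2^-1 :> R by lra.
  rewrite half in rm *; rewrite -(scalerDr _ (A u - y)) normrZ exprMn.
  rewrite ger0_norm//.
  have /andP[wk _] := w0 k.
  have par : `|(A u - y) + (A v - y)| ^+ 2 <=
      2 * (`|A u - y| ^+ 2 + `|A v - y| ^+ 2).
    have := sqr_ge0 `|(A u - y) - (A v - y)|.
    rewrite (sqnormB ipP (_ - _)) (sqnormD ipP (A u - y)) => ?; lra.
  have := ler_wpM2l wk par.
  lra.
- by move=> k u Du; have /andP[wk _] := w0 k; rewrite addr_ge0 ?r_ge0// mulr_ge0// exprn_ge0.
- by move=> k u Du; have /andP[wk wk1] := w0 k; rewrite lerD2l ler_wpM2r// exprn_ge0.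
- move=> k u x a ux Du Fa.
  have qx : (fun l => w k * `|A (u l) - y| ^+ 2) @ \oo --> w k * `|A x - y| ^+ 2.
    apply: cvgMr; apply: (@cvg_comp _ _ _ _ (fun a : R => a ^+ 2)); last exact: exprn_continuous.
    apply: cvg_norm; apply: cvgB; last exact: cvg_cst.
    by apply: cvg_comp; [exact: ux|exact: continuous_bounded_op].
  (* The penalty is continuous along [u], so up to [e] its limit can be moved to the right-hand side
     before lower semi-continuity of [r] is used. *)
  have H e : 0 < e -> D x /\ r x <= a - w k * `|A x - y| ^+ 2 + e.
    move=> e0; apply: (r_lsc _ _ _ ux) => //; near=> l.
    have h : F k (u l) <= a by near: l.
    have : w k * `|A x - y| ^+ 2 - e < w k * `|A (u l) - y| ^+ 2.
      by near: l; apply: (cvgr_gt _ qx); rewrite ltrBlDr ltrDl.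
    by move: h; rewrite /F => h h'; lra.
  split; first by have [] := H 1 ltr01.
  rewrite /F -lerBrDr; apply/ler_addgt0Pr => e e0.
  by have [] := H e e0.
Unshelve. all: by end_near. Qed.

(* Only the penalized problems [r + k |A . - y|^2] are solved: their residuals,
   scaled by [- 2 k], are nearly optimal dual variables. *)
Lemma strong_duality (y : Y) (rdag : R) : D !=set0 ->
  (forall z, D z -> A z = y -> rdag <= r z) ->
  forall e, 0 < e -> exists l : Y,
    forall z, D z -> rdag - r z + ip l (A z - y) <= e.
Proof.
move=> D0 rdagP e e0.
pose F k z := r z + k%:R * `|A z - y| ^+ 2.
(* Otherwise one point [x] would have penalized value at most [rdag - e] for every weight; this
   forces [A x = y], and then the weight 0 contradicts the lower bound [rdag] on solutions. *)
have [k Vk] : exists k : nat, rdag - e < inf (F k @` D).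
  apply: contrapT => h.
  have /= := @penalized_min y (fun k => k%:R) (rdag - e) D0.
  case=> [k|k|x Dx xV]; first by rewrite ler0n ler_nat leqnSn.
    by rewrite leNgt; apply/negP => ?; apply: h; exists k.
  have Axy : A x = y.
    apply/eqP; rewrite -subr_eq0 -normr_eq0 -sqrf_eq0 eq_le sqr_ge0 andbT.
    rewrite leNgt; apply/negP => q0.
    (* With weight [K.+1] the penalty alone exceeds [rdag - e], against [r x >= 0]. *)
    pose K := Num.truncn ((rdag - e) / `|A x - y| ^+ 2).
    have := xV K.+1; have := r_ge0 _ Dx.
    have : (rdag - e) / `|A x - y| ^+ 2 < K.+1%:R by rewrite truncnS_gt.
    by rewrite ltr_pdivrMr// => h1 h2 h3; lra.
  have := xV 0%N; have := rdagP _ Dx Axy; rewrite mul0r => h1 h2; lra.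
have [x Dx xmin] := @penalized_min y (fun=> k%:R) (inf (F k @` D)) D0
  (fun=> introT andP (conj (ler0n _ _) (lexx _))) (fun=> lexx _).
have {}xmin z : D z -> F k x <= F k z.
  move=> Dz; rewrite (le_trans (xmin 0%N))//; apply: ge_inf; last by exists z.
  by exists 0 => _ [z' Dz' <-]; rewrite addr_ge0 ?r_ge0// mulr_ge0// exprn_ge0.
have {}Vk : rdag - e < F k x.
  apply: (lt_le_trans Vk); apply: ge_inf; last by exists x.
  by exists 0 => _ [z' Dz' <-]; rewrite addr_ge0 ?r_ge0// mulr_ge0// exprn_ge0.
exists (- (2 * k%:R) *: (A x - y)) => z Dz.
(* First-order optimality of the penalized minimizer [x], by comparison with [s z + (1 - s) x] as
   [s] tends to 0. *)
have opt : 0 <= r z - r x + 2 * k%:R * ip (A x - y) (A z - A x).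
  apply: (@ge0_of_affine_ge0 _ _ (k%:R * `|A z - A x| ^+ 2)) => s /andP[s0 s1].
  have s01 : 0 <= s <= 1 by rewrite ltW.
  have [Ds rs] := r_convex _ _ _ Dz Dx s01.
  have := xmin _ Ds; rewrite /F affine_comb_opB.
  have -> : s *: (A z - y) + (1 - s) *: (A x - y) = (A x - y) + s *: (A z - A x).
    rewrite scalerBl scale1r addrCA -scalerBr; congr (_ + _ *: _).
    by rewrite opprB addrA subrK.
  rewrite (sqnormD ipP (A x - y)) (ipZr ipP) normrZ exprMn (ger0_norm (ltW s0)) => h.
  have n0 : 0 <= c0 * s * (1 - s) * `|z - x| ^+ 2.
    by rewrite !mulr_ge0 ?exprn_ge0 ?subr_ge0 ?(ltW s0) ?(ltW c0_gt0).
  rewrite -(pmulr_rge0 _ s0).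
  move: (`|A z - A x| ^+ 2) (ip _ _) (`|A x - y| ^+ 2) (`|z - x| ^+ 2) (k%:R) h n0 rs
    => a b c d' k'; nra.
(* The residual now contributes -2k |A x - y|^2, which outweighs the k |A x - y|^2 coming from
   [Vk]. *)
have -> : A z - y = (A x - y) + (A z - A x).
  by rewrite [RHS]addrC addrA subrK.
rewrite (ipZl ipP) (ipDr ipP) (ip_sqnorm ipP).
have := sqr_ge0 `|A x - y|; have := ler0n R k.
move: Vk opt; rewrite /F.
move: (`|A x - y| ^+ 2) (ip _ _) (k%:R) => a b k'; nra.
Qed.

(** A linear tilt preserves strong convexity, and at a minimizer the segment comparison leaves the
    full modulus [c0] as [s] tends to 0. It serves both the descent estimate and the lower bound on
    the Bregman distance. *)
Lemma linear_tilt_min_growth (l : Y) x : D x ->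
  (forall z, D z -> r x - ip l (A x) <= r z - ip l (A z)) ->
  forall z, D z -> r x - ip l (A x) + c0 * `|z - x| ^+ 2 <= r z - ip l (A z).
Proof.
move=> Dx xmin z Dz; rewrite -subr_ge0.
apply: (@ge0_of_affine_ge0 _ _ (c0 * `|z - x| ^+ 2)) => s /andP[s0 s1].
have s01 : 0 <= s <= 1 by rewrite ltW.
have [Ds rs] := r_convex _ _ _ Dz Dx s01.
have := xmin _ Ds; rewrite linearD !linearZ/= (ipDr ipP) !(ipZr ipP) => h.
rewrite -(pmulr_rge0 _ s0).
move: (ip _ _) (ip _ _) (`|z - x| ^+ 2) h rs => a b d'; nra.
Qed.

Section dual_gradient_descent.
Context {y ebar : Y} {rdag gamma : R} {l : nat -> Y} {x : nat -> X}.
Hypothesis Dx : forall t, D (x t).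
Hypothesis l0 : l 0%N = 0.
Hypothesis lS : forall t, l t.+1 = l t - gamma *: (A (x t) - y - ebar).
Hypothesis x_min : forall t z, D z ->
  r (x t) - ip (l t) (A (x t)) <= r z - ip (l t) (A z).
Hypothesis gamma_gt0 : 0 < gamma.
Hypothesis gamma_small : gamma * opnorm A ^+ 2 < 4 * c0.

(* [g t] is the dual objective at [l t]. The iteration is exact gradient descent
   for the perturbed objective [G]. *)
Let g t := rdag - r (x t) + ip (l t) (A (x t) - y).
Let G t := g t - ip (l t) ebar.
(** The decrease factor gamma (1 - gamma L / 2) of gradient descent, with smoothness constant L =
    |A|^2 / (2 c0). *)
Let kappa := gamma * (1 - gamma * opnorm A ^+ 2 / (4 * c0)).

Let kappa_gt0 : 0 < kappa.
Proof. by rewrite mulr_gt0// subr_gt0 ltr_pdivrMr ?mul1r// mulr_gt0. Qed.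

Lemma dual_descent t : G t.+1 <= G t - kappa * `|A (x t) - y - ebar| ^+ 2.
Proof.
have growth := linear_tilt_min_growth _ _ (Dx t) (x_min t) _ (Dx t.+1).
set d := A (x t) - y - ebar; set q := `|d| ^+ 2.
set a := c0 * `|x t.+1 - x t| ^+ 2 in growth.
have lSd : l t.+1 = l t + - gamma *: d by rewrite lS scaleNr.
(* Cauchy-Schwarz, the operator norm and the arithmetic-geometric inequality; the term [a] is
   exactly what [growth] pays back. *)
have cross : - gamma * ip d (A (x t.+1) - A (x t)) <=
    a + gamma * (gamma * opnorm A ^+ 2 / (4 * c0)) * q.
  rewrite -(ipZl ipP) (le_trans (le_ip ipP _ _))// -linearB.
  rewrite normrZ normrN gtr0_norm//.
  rewrite (le_trans (ler_wpM2l _ (norm_le_opnorm _ _ _ _ _ A_bounded)))//.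
    by rewrite mulr_ge0// ltW.
  have c04 : 0 < 4 * c0 by rewrite mulr_gt0.
  rewrite -(ler_pM2l c04) mulrDr /a /q.
  move: (`|x t.+1 - x t|) (`|d|) (opnorm A) => v w N.
  have -> : 4 * c0 * (gamma * (gamma * N ^+ 2 / (4 * c0)) * w ^+ 2) =
     (gamma * N * w) ^+ 2 by field; rewrite gt_eqF.
  have := sqr_ge0 (2 * c0 * v - gamma * N * w); nra.
have dq : gamma * (ip d (A (x t)) - ip d y - ip d ebar) = gamma * q.
  by rewrite /q -(ip_sqnorm ipP) -!(ipBr ipP).
rewrite (ipBr ipP) in cross.
rewrite /G /g lSd !(ipDl ipP) !(ipBr ipP) !(ipZl ipP) /kappa.
lra.
Qed.

(** The left-hand side is a Lyapunov function, shown nonincreasing in [t]. The extra weight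
    [gamma ^+ 2 / kappa] turns the descent of [G] into control of the squared step length. *)
Lemma dual_energy (lb : Y) (e : R) t :
  (forall z, D z -> rdag - r z + ip lb (A z - y) <= e) ->
  (2 * gamma * t%:R + gamma ^+ 2 / kappa) * (G t - (e - ip lb ebar))
    + `|l t - lb| ^+ 2 <=
  `|lb| ^+ 2 + gamma ^+ 2 / kappa * (G 0%N - (e - ip lb ebar)).
Proof.
move=> lbP; elim: t => [|t].
  by rewrite mulr0 add0r l0 sub0r normrN addrC.
apply: le_trans; set C := gamma ^+ 2 / kappa; set B := e - ip lb ebar.
have desc := dual_descent t.
(* [A (x t) - y - ebar] is a subgradient of the perturbed dual objective at [l t], and [B] bounds
   that objective at [lb]. *)
have cvx : G t - B <= ip (l t - lb) (A (x t) - y - ebar).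
  have := lbP _ (Dx t).
  by rewrite /G /g /B !(ipBl ipP) !(ipBr ipP) => ?; lra.
have -> : l t.+1 - lb = (l t - lb) - gamma *: (A (x t) - y - ebar).
  by rewrite lS addrAC.
rewrite (sqnormB ipP) (ipZr ipP) normrZ exprMn real_normK ?num_real//.
have q0 := sqr_ge0 `|A (x t) - y - ebar|.
have Cq : gamma ^+ 2 * `|A (x t) - y - ebar| ^+ 2 <= C * (G t - G t.+1).
  rewrite /C -mulrA ler_wpM2l ?sqr_ge0// ler_pdivlMl//; lra.
have Gmono : G t.+1 <= G t.
  by rewrite (le_trans desc)// gerBl mulr_ge0// ltW.
have t0 := ler0n R t.
have tG : 2 * gamma * t%:R * G t.+1 <= 2 * gamma * t%:R * G t.
  by rewrite ler_wpM2l// !mulr_ge0// ltW.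
have g1 : gamma * G t.+1 <= gamma * G t by rewrite ler_wpM2l// ltW.
have g2 := ler_wpM2l (ltW gamma_gt0) cvx.
rewrite -natr1; lra.
Qed.

Lemma dual_gradient_descent_bound (lb : Y) (e : R) t
    (C := gamma ^+ 2 / kappa) (S := 2 * gamma * t%:R + C) :
  0 < e ->
  (forall z, D z -> rdag - r z + ip lb (A z - y) <= e) ->
  g t <= e + ((1 + C) * `|lb| ^+ 2 + C * `|rdag|) / S + (S / 4 + 1) * `|ebar| ^+ 2.
Proof.
move=> e0 lbP.
have := dual_energy _ _ t lbP; rewrite -/C -/S => en.
have C0 : 0 < C by rewrite divr_gt0 ?exprn_gt0.
have CS : C <= S by rewrite lerDr !mulr_ge0// ltW.
have S0 : 0 < S := lt_le_trans C0 CS.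
have G0 : G 0%N <= `|rdag|.
  rewrite /G /g l0 !(ip0l ipP) subr0 addr0 (le_trans _ (ler_norm _))// gerBl.
  exact: r_ge0.
(* The factor [S] makes the squared distance to [lb] cancel the one in the energy. The term
   [C * ip lb ebar] is absorbed by [y2] and [C <= S]. *)
have y1 := ip_young ipP (l t - lb) ebar S.
have y2 := ip_young ipP lb ebar 1.
have n1 := sqr_ge0 `|lb|; have n2 := sqr_ge0 `|ebar|.
have CG := ler_wpM2l (ltW C0) G0.
have Cy := ler_wpM2l (ltW C0) y2.
have CSe := ler_wpM2r n2 CS.
have Ce : 0 <= C * e by rewrite mulr_ge0// ltW.
have Cn1 : 0 <= C * `|lb| ^+ 2 by rewrite mulr_ge0// ltW.
have Cn2 : 0 <= C * `|ebar| ^+ 2 by rewrite mulr_ge0// ltW.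
rewrite (ipBl ipP) in y1; move: en; rewrite [G t]/G.
move: (G 0%N) (g t) CG => G0' g' CG en; clearbody C S.
rewrite -(ler_pM2l S0) !(mulrDr S) [S * (_ / S)]mulrCA divff ?gt_eqF// mulr1.
lra.
Qed.

End dual_gradient_descent.
End deterministic.

(** * Independent real random variables and nearest-point approximation *)

(** Preimages of open rays are open, and open rays generate the Borel sets of the line. Hypotheses
    on the law of the samples thus reach real functions of them. *)
Lemma borel_preimage_continuous (R : realType) (Y : normedModType R) (f : Y -> R)
    (C : set R) :
  continuous f -> measurable C -> borel_set (f @^-1` C).
Proof.
move=> cf mC.
have mf : measurable_fun [set: g_sigma_algebraType (@open Y)]
    (f : g_sigma_algebraType (@open Y) -> R).
  apply: (measurability _ (RGenOInfty.measurableE R)) => _ [_ [x ->] <-].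
  rewrite setTI; apply: sub_sigma_algebra.
  by apply: open_comp; [move=> ? _; exact: cf|exact: interval_open].
by have := mf measurableT C mC; rewrite setTI.
Qed.

Lemma borel_setI (T : ptopologicalType) (B C : set T) :
  borel_set B -> borel_set C -> borel_set (B `&` C).
Proof.
by move=> mB mC; have := @measurableI _ (g_sigma_algebraType (@open T)) B C mB mC.
Qed.

Lemma borel_setD (T : ptopologicalType) (B C : set T) :
  borel_set B -> borel_set C -> borel_set (B `\` C).
Proof.
by move=> mB mC; have := @measurableD _ (g_sigma_algebraType (@open T)) B C mB mC.
Qed.

Section real_random_variables.
Context {R : realType} {d : measure_display} {Omega : measurableType d}.
Context {P : probability Omega R}.
Local Open Scope ereal_scope.

(** Independence says that the image under [U] of [P] restricted to [E] is the law of [U] scaled by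
    [P E]; both integrals are then computed on the real line. *)
Lemma ge0_integral_indep (U : Omega -> R) (E : set Omega) (g : R -> \bar R) :
  measurable_fun setT U -> measurable E ->
  (forall C, measurable C -> P (U @^-1` C `&` E) = P (U @^-1` C) * P E) ->
  measurable_fun [set: R] g -> (forall x, 0 <= g x) ->
  \int[P]_(w in E) g (U w) = P E * \int[P]_w g (U w).
Proof.
move=> mU mE UE mg g0.
pose mu := mrestr P mE.
pose p := NngNum (fine_ge0 (measure_ge0 P E)).
have PE : P E = (p%:num)%:E by rewrite /= fineK// fin_num_measure.
transitivity (\int[mu]_(w in E) g (U w)).
  by apply: eq_measure_integral => B mB BE; rewrite /= /mu /mrestr (setIidl BE).
transitivity (\int[mu]_w g (U w)).
  rewrite [RHS](@ge0_negligible_integral _ _ _ mu setT (~` E))//.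
  - by rewrite setTD setCK.
  - exact: measurableC.
  - exact: measurableT_comp.
  - by rewrite /mu /= /mrestr setICl measure0.
rewrite -(@ge0_integral_pushforward _ _ _ _ _ U mU mu setT g)//.
rewrite (@eq_measure_integral _ _ _ _ (mscale p (pushforward P U)))/=; last first.
  by move=> C mC _; rewrite /pushforward /mscale /mu /mrestr /= UE// PE muleC.
rewrite ge0_integral_mscale// PE; congr (_ * _).
by rewrite ge0_integral_pushforward.
Qed.

Lemma integral_indep (U : Omega -> R) (E : set Omega) :
  measurable_fun setT U -> measurable E ->
  (forall C, measurable C -> P (U @^-1` C `&` E) = P (U @^-1` C) * P E) ->
  P.-integrable setT (EFin \o U) ->
  \int[P]_(w in E) (U w)%:E = P E * \int[P]_w (U w)%:E.
Proof.
move=> mU mE UE iU.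
have mEFin : measurable_fun [set: R] (@EFin R) by exact: EFin_measurable.
rewrite integralE [in RHS]integralE.
rewrite (funepos_comp EFin U) (funeneg_comp EFin U).
rewrite (ge0_integral_indep U E (@EFin R)^\+ mU mE UE)//; last first.
  exact: measurable_funepos.
rewrite (ge0_integral_indep U E (@EFin R)^\- mU mE UE)//; last first.
  exact: measurable_funeneg.
rewrite [RHS]muleBr ?fin_num_measure//.
by have := integrable_add_def measurableT iU; rewrite (funepos_comp EFin U) (funeneg_comp EFin U).
Qed.

Section same_law.
Context {U V : Omega -> R}.
Hypothesis mU : measurable_fun setT U.
Hypothesis mV : measurable_fun setT V.
Hypothesis UV : forall C, measurable C -> P (U @^-1` C) = P (V @^-1` C).

Lemma ge0_integral_same_law (g : R -> \bar R) :
  measurable_fun [set: R] g -> (forall x, 0 <= g x) ->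
  \int[P]_w g (U w) = \int[P]_w g (V w).
Proof.
move=> mg g0.
rewrite -(@ge0_integral_pushforward _ _ _ _ _ U mU P setT g)//.
rewrite -[RHS](@ge0_integral_pushforward _ _ _ _ _ V mV P setT g)//.
by apply: eq_measure_integral => C mC _; exact: UV.
Qed.

Lemma integrable_same_law :
  P.-integrable setT (EFin \o V) -> P.-integrable setT (EFin \o U).
Proof.
move=> /integrableP[_ iV]; apply/integrableP; split.
  exact: measurableT_comp.
rewrite (le_lt_trans _ iV)//.
rewrite (@ge0_integral_same_law (fun x => `|x%:E|))//.
by apply: measurableT_comp => //; exact: EFin_measurable.
Qed.

Lemma integral_same_law : \int[P]_w (U w)%:E = \int[P]_w (V w)%:E.
Proof.
have mEFin : measurable_fun [set: R] (@EFin R) by exact: EFin_measurable.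
rewrite integralE [in RHS]integralE.
rewrite (funepos_comp EFin U) (funeneg_comp EFin U).
rewrite (funepos_comp EFin V) (funeneg_comp EFin V).
congr (_ - _).
  exact: ge0_integral_same_law (measurable_funepos mEFin) (@funepos_ge0 _ _ _).
exact: ge0_integral_same_law (measurable_funeneg mEFin) (@funeneg_ge0 _ _ _).
Qed.

End same_law.
End real_random_variables.

(* Finitely-valued Borel maps tending to the identity on the closure of the range
   of [v]. They reduce the independence of [Y]-valued variables to that of events. *)
Fixpoint nearest {R : realType} {Y : normedModType R} (v : nat -> Y) n (u : Y) : Y :=
  if n is m.+1 then
    if `|u - v m| < `|u - nearest v m u| then v m else nearest v m u
  else 0.

Section nearest.
Context {R : realType} {Y : normedModType R} (v : nat -> Y).

Lemma dist_nearestS n u :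
  `|u - nearest v n.+1 u| = Num.min `|u - v n| `|u - nearest v n u|.
Proof. by rewrite /= /Order.min; case: ifP. Qed.

Lemma continuous_dist_nearest n : continuous (fun u => `|u - nearest v n u|).
Proof.
elim: n => [|n ih].
  by move=> u; under eq_fun do rewrite /= subr0; exact: norm_continuous.
under eq_fun do rewrite dist_nearestS.
move=> u; have c1 : {for u, continuous (fun u => `|u - v n| : R^o)}.
  by apply: cvg_norm; apply: cvgB; [exact: cvg_id|exact: cvg_cst].
exact: (continuous_min c1 (ih u)).
Qed.

Lemma dist_nearest_le0 n u : `|u - nearest v n u| <= `|u|.
Proof.
by elim: n => [|n ih]; rewrite ?subr0// dist_nearestS ge_min ih orbT.
Qed.

Lemma dist_nearest_le n m u : (m < n)%N -> `|u - nearest v n u| <= `|u - v m|.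
Proof.
elim: n => // n ih; rewrite ltnS leq_eqVlt dist_nearestS ge_min.
by move=> /predU1P[->|/ih ->]; rewrite ?lexx ?orbT.
Qed.

(** The default value 0 competes from the start, so the distance never exceeds the norm of [u]. This
    supplies the integrable majorant for dominated convergence. *)
Lemma norm_nearest_le n u : `|nearest v n u| <= 2 * `|u|.
Proof.
have -> : nearest v n u = u - (u - nearest v n u) by rewrite subKr.
by rewrite (le_trans (ler_normB _ _))// mulr_natl mulr2n lerD2l dist_nearest_le0.
Qed.

Lemma cvg_nearest u : (forall e, 0 < e -> exists m, `|u - v m| < e) ->
  (fun n => nearest v n u) @ \oo --> u.
Proof.
move=> uv; apply/cvgrPdist_lt => e /uv[m um].
by exists m.+1 => // n /= mn; rewrite (le_lt_trans (dist_nearest_le _ _ _ mn)).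
Qed.

End nearest.

Lemma strongly_measurable_separable (R : realType) (Y : normedModType R)
    (d : measure_display) (Omega : measurableType d) (f : Omega -> Y) :
  strongly_measurable f ->
  exists v : nat -> Y, forall w e, 0 < e -> exists m, `|f w - v m| < e.
Proof.
move=> [s [s_simple s_f]].
pose S := \bigcup_k range (s k).
have : countable S.
  apply: bigcup_countable => // k _; apply: finite_set_countable.
  by have [] := s_simple k.
move=> /countable_injP[h h_inj].
(* The countable union [S] of the simple ranges is enumerated by inverting the injection [h];
   indices outside its image receive an irrelevant default. *)
exists (fun n => get [set u | S u /\ h u = n]) => w e e0.
have /cvgrPdist_lt /(_ _ e0)[k _ /(_ k (leqnn k)) fk] := s_f w.
have Sk : S (s k w) by exists k => //; exists w.
exists (h (s k w)).
have [Sg hg] := @getPex _ [set u | S u /\ h u = h (s k w)] (ex_intro _ _ (conj Sk erefl)).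
by rewrite (h_inj _ _ _ _ hg) ?inE.
Qed.

(** * Variance of the sample mean *)

Section iid_sample.
Context {R : realType} {Y : normedModType R} {ip : Y -> Y -> R}.
Context {d : measure_display} {Omega : measurableType d} {P : probability Omega R}.
Context {ys : nat -> Omega -> Y} {y : Y}.
Hypothesis ipP : is_inner_product ip.
Hypothesis ys_borel : forall i, borel_measurable_fun (ys i).
Hypothesis ys_strong : forall i, strongly_measurable (ys i).
Hypothesis ys_indep : mutually_independent P ys.
Hypothesis ys_id : identically_distributed P ys.
Hypothesis ys_int : forall v, P.-integrable setT (fun w => (ip v (ys 0%N w))%:E).
Hypothesis ys_mean : forall v, (\int[P]_w (ip v (ys 0%N w))%:E = (ip v y)%:E)%E.
Hypothesis ys_var : (\int[P]_w (`|ys 0%N w - y| ^+ 2)%:E < +oo)%E.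

Let X i w := ys i w - y.

Let continuous_dev v : continuous (fun u => ip (u - y) v).
Proof.
move=> u; under eq_fun do rewrite (ipC ipP).
apply: (@cvg_comp _ _ _ (fun u => u - y) (ip v)); last exact: continuous_ip.
by apply: cvgB; [exact: cvg_id|exact: cvg_cst].
Qed.

Let continuous_sqdev : continuous (fun u => `|u - y| ^+ 2).
Proof.
move=> u; apply: (@cvg_comp _ _ _ _ (fun a : R => a ^+ 2)); last exact: exprn_continuous.
by apply: cvg_norm; apply: cvgB; [exact: cvg_id|exact: cvg_cst].
Qed.

Let measurable_comp_sample i (f : Y -> R) :
  continuous f -> measurable_fun setT (f \o ys i).
Proof.
move=> cf _ C mC; rewrite setTI.
exact: ys_borel (borel_preimage_continuous _ _ _ _ cf mC).
Qed.

Let same_law i (f : Y -> R) : continuous f ->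
  forall C, measurable C -> P ((f \o ys i) @^-1` C) = P ((f \o ys 0%N) @^-1` C).
Proof.
by move=> cf C mC; exact: ys_id (borel_preimage_continuous _ _ _ _ cf mC).
Qed.

Let pairwise_indep i j B C : i != j -> borel_set B -> borel_set C ->
  (P (ys i @^-1` B `&` ys j @^-1` C) = P (ys i @^-1` B) * P (ys j @^-1` C))%E.
Proof.
move=> ij mB mC.
have ji : j != i by rewrite eq_sym.
have := ys_indep [:: i; j] (fun k => if k == i then B else C).
rewrite !big_cons !big_nil /= inE ij eqxx (negbTE ji) setIT mule1; apply => //.
by move=> k _; case: ifP.
Qed.

(** Integrability is assumed for the first sample only and is carried to index [i] by equality of
    laws. *)
Lemma centered_integrable i v :
  P.-integrable setT (fun w => (ip (X i w) v)%:E).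
Proof.
have cf := continuous_dev v.
apply: (@integrable_same_law _ _ _ P _ ((fun u => ip (u - y) v) \o ys 0%N)) => //.
- exact: (measurable_comp_sample i _ cf).
- exact: (measurable_comp_sample 0%N _ cf).
- exact: same_law.
have icst : P.-integrable setT (EFin \o cst (ip v y)).
  exact: finite_measure_integrable_cst.
apply: eq_integrable (integrableB measurableT (ys_int v) icst) => //= w _.
by rewrite (ipBl ipP) !(ipC ipP _ v).
Qed.

Lemma centered_mean i v : (\int[P]_w (ip (X i w) v)%:E = 0)%E.
Proof.
have cf := continuous_dev v.
rewrite (@integral_same_law _ _ _ P _ ((fun u => ip (u - y) v) \o ys 0%N)).
- have icst : P.-integrable setT (EFin \o cst (ip v y)).
    exact: finite_measure_integrable_cst.
  rewrite (eq_integral (fun w => (ip v (ys 0%N w))%:E - (EFin \o cst (ip v y)) w)%E).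
    rewrite integralB//= ys_mean integral_cst//= probability_setT mule1.
    by rewrite -EFinB subrr.
  by move=> w _ /=; rewrite (ipBl ipP) !(ipC ipP _ v).
- exact: (measurable_comp_sample i _ cf).
- exact: (measurable_comp_sample 0%N _ cf).
- exact: same_law.
Qed.

Lemma sqdev_integrable i : P.-integrable setT (fun w => (`|X i w| ^+ 2)%:E).
Proof.
apply: (@integrable_same_law _ _ _ P _ ((fun u => `|u - y| ^+ 2) \o ys 0%N)).
- exact: (measurable_comp_sample i _ continuous_sqdev).
- exact: (measurable_comp_sample 0%N _ continuous_sqdev).
- exact: (same_law i _ continuous_sqdev).
apply/integrableP; split.
  exact/measurable_EFinP/(measurable_comp_sample 0%N _ continuous_sqdev).
by under eq_integral do rewrite /= ger0_norm ?exprn_ge0//.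
Qed.

Lemma sqdev_integral i :
  (\int[P]_w (`|X i w| ^+ 2)%:E = \int[P]_w (`|ys 0%N w - y| ^+ 2)%:E)%E.
Proof.
apply: (@integral_same_law _ _ _ P _ ((fun u => `|u - y| ^+ 2) \o ys 0%N)).
- exact: (measurable_comp_sample i _ continuous_sqdev).
- exact: (measurable_comp_sample 0%N _ continuous_sqdev).
- exact: (same_law i _ continuous_sqdev).
Qed.

Let measurable_sample i B : borel_set B -> measurable (ys i @^-1` B).
Proof. exact: ys_borel. Qed.

(** Induction on [n]: where [v n] wins, the second factor is constant and independence with
    centering gives 0; elsewhere the previous map applies. Quantifying over all Borel [B] lets the
    induction restrict to [B] minus the winning set. *)
Lemma cross_nearest i j (v : nat -> Y) n : i != j ->
  P.-integrable setT (fun w => (ip (X i w) (nearest v n (ys j w)))%:E) /\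
  forall B, borel_set B ->
    (\int[P]_(w in ys j @^-1` B) (ip (X i w) (nearest v n (ys j w)))%:E = 0)%E.
Proof.
move=> ij; elim: n => [|n [ih_int ih]].
  under eq_fun do rewrite /= (ip0r ipP).
  split; first exact: integrable0.
  by move=> B mB; exact: integral0.
pose C : set Y := [set u | `|u - v n| < `|u - nearest v n u|].
(* The winning set is open: [nearest] itself may jump, but the distance to it is continuous. *)
have mC : borel_set C.
  apply: sub_sigma_algebra; rewrite /C.
  rewrite (_ : [set _ | _] =
    (fun u => `|u - nearest v n u| - `|u - v n|) @^-1` [set a | 0 < a]); last first.
    by apply/seteqP; split => u /=; rewrite subr_gt0.
  apply: open_comp; last exact: open_gt.
  move=> u _; apply: cvgB; first exact: continuous_dist_nearest.
  by apply: cvg_norm; apply: cvgB; [exact: cvg_id|exact: cvg_cst].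
have mE := measurable_sample j _ mC.
set E := ys j @^-1` C in mE.
have in_E w : E w -> nearest v n.+1 (ys j w) = v n.
  by rewrite /E /C /= => ->.
have notin_E w : ~ E w -> nearest v n.+1 (ys j w) = nearest v n (ys j w).
  by rewrite /E /C /= => /negP/negbTE ->.
have int_n1 : P.-integrable setT
    (fun w => (ip (X i w) (nearest v n.+1 (ys j w)))%:E).
  have i1 : P.-integrable setT ((fun w => (ip (X i w) (v n))%:E) \_ E).
    apply: (@integrable_mkcond _ _ _ P E _ mE).1.
    by apply: (integrableS measurableT) => //; exact: centered_integrable.
  have i2 : P.-integrable setT
      ((fun w => (ip (X i w) (nearest v n (ys j w)))%:E) \_ (~` E)).
    apply: (@integrable_mkcond _ _ _ P (~` E) _ (measurableC mE)).1.
    by apply: (integrableS measurableT) => //; exact: measurableC.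
  apply: eq_integrable (integrableD measurableT i1 i2) => // w _.
  rewrite [LHS]/= !patchE in_setC (_ : point = 0%E)//.
  have [wE|wE] := boolP (w \in E); rewrite ?adde0 ?add0e.
    by rewrite in_E//; rewrite inE in wE.
  by rewrite notin_E// => Ew; move: wE; rewrite mem_set.
split=> // B mB.
have mBC : borel_set (B `&` C) by exact: borel_setI.
have mBD : borel_set (B `\` C) by exact: borel_setD.
have m1 := measurable_sample j _ mBC; have m2 := measurable_sample j _ mBD.
have -> : ys j @^-1` B = ys j @^-1` (B `&` C) `|` ys j @^-1` (B `\` C).
  by rewrite -preimage_setU setUIDK.
rewrite integral_setU//; first last.
- apply/disj_setPS => w [[_ h] [_ h']]; exact: h'.
- apply: measurable_funTS; exact: (measurable_int _ int_n1).
rewrite (eq_integral (fun w => (ip (X i w) (v n))%:E)); last first.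
  by move=> w; rewrite inE => -[_ /in_E ->].
rewrite [X in (_ + X)%E](eq_integral (fun w => (ip (X i w) (nearest v n (ys j w)))%:E));
  last by move=> w; rewrite inE => -[_ /notin_E ->].
rewrite (ih _ mBD) adde0.
rewrite (@integral_indep _ _ _ P (fun w => ip (X i w) (v n))).
- by rewrite (centered_mean i) mule0.
- exact: (measurable_comp_sample i _ (continuous_dev (v n))).
- by [].
- move=> D mD.
  have bD := borel_preimage_continuous _ _ _ _ (continuous_dev (v n)) mD.
  exact: (pairwise_indep i j _ _ ij bD mBC).
- exact: centered_integrable.
Qed.

(* By dominated convergence, replacing [ys j] with [nearest v n (ys j)]. *)
Lemma cross i j : i != j ->
  P.-integrable setT (fun w => (ip (X i w) (X j w))%:E) /\
  (\int[P]_w (ip (X i w) (X j w))%:E = 0)%E.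
Proof.
move=> ij.
have [v vP] := strongly_measurable_separable _ _ _ _ _ (ys_strong j).
pose f n w := (ip (X i w) (nearest v n (ys j w)))%:E.
(* The limit pairs with [ys j] itself; subtracting [y] afterwards removes only a term of mean
   zero. *)
pose f' w := (ip (X i w) (ys j w))%:E.
(* With a, b, c the norms of [X i w], [X j w] and [y], this dominates 2a(b + c), since 2a(b + c) <=
   a^2 + (b + c)^2. *)
pose g w := (`|X i w| ^+ 2 + (2 * `|X j w| ^+ 2 + 2 * `|y| ^+ 2))%:E.
have mf n : measurable_fun setT (f n).
  by have [/measurable_int] := cross_nearest i j v n ij.
have cvgf w : f ^~ w @ \oo --> f' w.
  apply: cvg_EFin; first by near=> n.
  apply: (@cvg_comp _ _ _ (fun n => nearest v n (ys j w)) (ip (X i w))).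
    by apply: cvg_nearest; exact: vP.
  exact: continuous_ip.
have mf' : measurable_fun setT f'.
  exact: (emeasurable_fun_cvg f) => // w _; exact: cvgf.
have ig : P.-integrable setT g.
  have i1 := sqdev_integrable i; have i2 := integrableZl measurableT 2 (sqdev_integrable j).
  have i3 : P.-integrable setT (EFin \o cst (2 * `|y| ^+ 2)).
    exact: finite_measure_integrable_cst.
  have := integrableD measurableT i1 (integrableD measurableT i2 i3).
  by apply: eq_integrable => // w _.
have fg w n : (`|f n w| <= g w)%E.
  rewrite /f /g lee_fin (le_trans (norm_ip ipP _ _))//.
  have n1 := norm_nearest_le v n (ys j w).
  have n2 : `|ys j w| <= `|X j w| + `|y|.
    by rewrite (le_trans _ (ler_normD _ _))// subrK.
  have n3 : `|nearest v n (ys j w)| <= 2 * (`|X j w| + `|y|) by lra.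
  have := ler_wpM2l (normr_ge0 (X i w)) n3 => n4; rewrite (le_trans n4)//.
  have := sqr_ge0 (`|X i w| - (`|X j w| + `|y|)).
  have := sqr_ge0 (`|X j w| - `|y|).
  move: (`|X i w|) (`|X j w|) (`|y|) => a b c; nra.
have [] := @dominated_convergence _ _ _ P setT measurableT f f' g mf mf'
  (aeW _ (fun w _ => cvgf w)) ig (aeW _ (fun w n _ => fg w n)).
move=> if' _ lim.
have f'0 : (\int[P]_w f' w = 0)%E.
  apply: (cvg_unique _ lim) => //.
  apply: cvg_near_cst; near=> n.
  have [_ /(_ setT)] := cross_nearest i j v n ij.
  rewrite preimage_setT; apply.
  by rewrite -[setT]setC0 -setTD; apply: borel_setD; apply: sub_sigma_algebra;
    [exact: openT|exact: open0].
have eqf w : (ip (X i w) (X j w))%:E = (f' w - (ip (X i w) y)%:E)%E.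
  by rewrite /f' -EFinB -(ipBr ipP).
split.
  have := integrableB measurableT if' (centered_integrable i y).
  by apply: eq_integrable => // w _; rewrite eqf.
under eq_integral do rewrite eqf.
by rewrite integralB//; [rewrite f'0 centered_mean subee|exact: centered_integrable].
Unshelve. all: by end_near. Qed.

Lemma cross_sum n j : (n <= j)%N ->
  P.-integrable setT (fun w => (ip (\sum_(i < n) X i w) (X j w))%:E) /\
  (\int[P]_w (ip (\sum_(i < n) X i w) (X j w))%:E = 0)%E.
Proof.
elim: n => [_|n ih nj].
  under eq_fun do rewrite big_ord0 (ip0l ipP).
  by split; [exact: integrable0|exact: integral0].
have [i1 z1] := ih (ltnW nj).
have [i2 z2] := cross n j (negbT (ltn_eqF nj)).
have eqS w : (ip (\sum_(i < n.+1) X i w) (X j w))%:E =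
    ((ip (\sum_(i < n) X i w) (X j w))%:E + (ip (X n w) (X j w))%:E)%E.
  by rewrite big_ord_recr/= (ipDl ipP) EFinD.
split.
  by apply: eq_integrable (integrableD measurableT i1 i2) => // w _; rewrite eqS.
under eq_integral do rewrite eqS.
by rewrite integralD// z1 z2 adde0.
Qed.

(** Pythagoras in mean square: each new deviation is uncorrelated with the partial sum before it. *)
Lemma sqnorm_sum n :
  P.-integrable setT (fun w => (`|\sum_(i < n) X i w| ^+ 2)%:E) /\
  (\int[P]_w (`|\sum_(i < n) X i w| ^+ 2)%:E =
    n%:R%:E * \int[P]_w (`|ys 0%N w - y| ^+ 2)%:E)%E.
Proof.
elim: n => [|n [i1 z1]].
  under eq_fun do rewrite big_ord0 normr0 expr0n.
  by rewrite mul0e; split; [exact: integrable0|exact: integral0].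
have [i2 z2] := cross_sum n n (leqnn n).
have i3 := sqdev_integrable n.
have i2' := integrableZl measurableT 2 i2.
have i12 := integrableD measurableT i1 i2'.
have eqS w : (`|\sum_(i < n.+1) X i w| ^+ 2)%:E =
    ((`|\sum_(i < n) X i w| ^+ 2)%:E + 2%:E * (ip (\sum_(i < n) X i w) (X n w))%:E
      + (`|X n w| ^+ 2)%:E)%E.
  by rewrite big_ord_recr/= (sqnormD ipP) !EFinD EFinM.
split.
  by apply: eq_integrable (integrableD measurableT i12 i3) => // w _; rewrite eqS.
under eq_integral do rewrite eqS.
rewrite integralD// integralD// integralZl// z1 z2 mule0 adde0 sqdev_integral.
by rewrite -natr1 EFinD ge0_muleDl ?lee_fin// mul1e.
Qed.

Lemma sample_mean_variance n : (0 < n)%N ->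
  P.-integrable setT (fun w => (`|n%:R^-1 *: \sum_(i < n) ys i w - y| ^+ 2)%:E) /\
  (\int[P]_w (`|n%:R^-1 *: \sum_(i < n) ys i w - y| ^+ 2)%:E =
    n%:R^-1%:E * \int[P]_w (`|ys 0%N w - y| ^+ 2)%:E)%E.
Proof.
move=> n0; have [i1 z1] := sqnorm_sum n.
have n_neq0 : n%:R != 0 :> R by rewrite pnatr_eq0 -lt0n.
have eqS w : (`|n%:R^-1 *: \sum_(i < n) ys i w - y| ^+ 2)%:E =
    ((n%:R^-1 ^+ 2)%:E * (`|\sum_(i < n) X i w| ^+ 2)%:E)%E.
  have -> : n%:R^-1 *: \sum_(i < n) ys i w - y = n%:R^-1 *: \sum_(i < n) X i w.
    rewrite sumrB scalerBr sumr_const card_ord -(scaler_nat n y) scalerA mulVf//.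
    by rewrite scale1r.
  by rewrite normrZ exprMn real_normK ?num_real// EFinM.
split.
  by apply: eq_integrable (integrableZl measurableT _ i1) => // w _; rewrite eqS.
under eq_integral do rewrite eqS.
rewrite integralZl// z1 muleA -EFinM; congr (_%:E * _)%E.
by rewrite expr2 -mulrA mulVf// mulr1.
Qed.

End iid_sample.

(** * Convergence *)

(* The iterates [x n t] need not be measurable; as a supremum over simple functions
   below the integrand, the integral is still monotone. *)
Lemma ge0_le_integral_nonmeasurable (R : realType) (d : measure_display)
    (T : measurableType d) (mu : {measure set T -> \bar R}) (f g : T -> \bar R) :
  (forall x, 0 <= f x)%E -> (forall x, f x <= g x)%E ->
  (\int[mu]_x f x <= \int[mu]_x g x)%E.
Proof.
move=> f0 fg; have g0 x : (0 <= g x)%E by exact: le_trans (fg x).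
rewrite !ge0_integralTE//; apply: le_ereal_sup => _ [h hf <-].
by exists h => // x; exact: le_trans (fg x).
Qed.

Lemma ge0_cvge0 (R : realType) (u : nat -> \bar R) :
  (\forall n \near \oo, 0 <= u n)%E ->
  (forall e : R, 0 < e -> \forall n \near \oo, (u n <= e%:E)%E) ->
  u @ \oo --> (0 : \bar R).
Proof.
move=> u0 ue.
have u_fin : \forall n \near \oo, u n \is a fin_num.
  near=> n; have un0 : (0 <= u n)%E by near: n.
  by rewrite ge0_fin_numE// (@le_lt_trans _ _ 1%:E)// ?ltry//; near: n; exact: ue.
apply/fine_cvgP; split => //.
apply/cvgrPdist_le => e e0; near=> n.
have un0 : (0 <= u n)%E by near: n.
rewrite /= sub0r normrN ger0_norm ?fine_ge0//.
rewrite -lee_fin fineK; first by near: n; exact: ue.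
by near: n.
Unshelve. all: by end_near. Qed.

(** A value above [a] at [x] would persist on a neighbourhood, which contains a tail of the
    sequence. *)
Lemma lower_semicontinuous_seq (R : realType) (X : topologicalType)
    (f : X -> \bar R) (u : nat -> X) x (a : R) :
  lower_semicontinuous f -> u @ \oo --> x ->
  (\forall l \near \oo, (f (u l) <= a%:E)%E) -> (f x <= a%:E)%E.
Proof.
move=> fl ux fa; rewrite leNgt; apply/negP => /fl[V Vx Va].
have Vu : \forall l \near \oo, V (u l) by exact: ux.
by have [l []] := filter_ex (filterI Vu fa); move=> /Va; rewrite ltNge => /negP.
Qed.

Lemma error_bound_small (R : realType) (tn : nat -> nat) (a C K s e : R) :
  0 < a -> 0 < C -> 0 <= K -> 0 <= s -> 0 < e ->
  (forall M : nat, \forall n \near \oo, (M <= tn n)%N) ->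
  (fun n => (tn n)%:R / n%:R : R) @ \oo --> (0 : R) ->
  \forall n \near \oo, K / (a * (tn n)%:R + C) +
    ((a * (tn n)%:R + C) / 4 + 1) * (n%:R^-1 * s) <= e.
Proof.
move=> a0 C0 K0 s0 e0 tn_oo tn_n.
(* The second term, expanded: it vanishes because [tn n / n] and [1 / n] do. The first vanishes
   because [tn] is unbounded; each receives half of [e]. *)
have lim : (fun n => (a / 4 * ((tn n)%:R / n%:R) + (C / 4 + 1) / n%:R) * s) @ \oo --> (0 : R).
  rewrite [X in _ --> X](_ : _ = (a / 4 * 0 + (C / 4 + 1) * 0) * s); last by ring.
  apply: cvgMl; apply: cvgD; apply: cvgMr => //.
  by rewrite -cvg_shiftS; exact: cvg_harmonic.
near=> n.
have e2 : 0 < e / 2 by lra.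
have S0 : 0 < a * (tn n)%:R + C by rewrite ltr_wpDl// mulr_ge0// ltW.
have h1 : K / (a * (tn n)%:R + C) <= e / 2.
  rewrite ler_pdivrMr// -ler_pdivrMl// (@le_trans _ _ (a * (tn n)%:R)) ?lerDl ?(ltW C0)//.
  rewrite -ler_pdivrMl//.
  apply: (@le_trans _ _ (Num.truncn (a^-1 * ((e / 2)^-1 * K))).+1%:R).
    by rewrite ltW// truncnS_gt.
  by rewrite ler_nat; near: n; exact: tn_oo.
have h2 : (a / 4 * ((tn n)%:R / n%:R) + (C / 4 + 1) / n%:R) * s < e / 2.
  by near: n; apply: (cvgr_lt _ lim); lra.
have -> : ((a * (tn n)%:R + C) / 4 + 1) * (n%:R^-1 * s) =
  (a / 4 * ((tn n)%:R / n%:R) + (C / 4 + 1) / n%:R) * s by ring.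
lra.
Unshelve. all: by end_near. Qed.

Theorem theorem3p6
  (R : realType)
  (X : completeNormedModType R)                (* Banach space *)
  (Y : completeNormedModType R) (ip : Y -> Y -> R) (* Hilbert space *)
  (A : {linear X -> Y})
  (Rf : X -> \bar R) (c0 : R)
  (y : Y) (xdag : X)
  (d : measure_display) (Omega : measurableType d) (P : probability Omega R)
  (ys : nat -> Omega -> Y)
  (gamma : R)
  (x : nat -> nat -> Omega -> X) (lam : nat -> nat -> Omega -> Y)
  (tn : nat -> nat) :
  is_inner_product ip ->
  bounded_op A ->
  (forall z, (0 <= Rf z)%E) -> proper_fun Rf -> lower_semicontinuous Rf ->
  0 < c0 -> strongly_convex c0 Rf ->
  (exists z, A z = y /\ dom Rf z) ->
  A xdag = y -> (forall z, A z = y -> (Rf xdag <= Rf z)%E) ->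
  (* y_i i.i.d. Y-valued random variables *)
  (forall i, borel_measurable_fun (ys i)) ->
  (forall i, strongly_measurable (ys i)) ->
  mutually_independent P ys ->
  identically_distributed P ys ->
  (* E[y_1] = y (tested against every v in Y) *)
  (forall v, P.-integrable setT (fun w => (ip v (ys 0%N w))%:E)) ->
  (forall v, (\int[P]_w (ip v (ys 0%N w))%:E = (ip v y)%:E)%E) ->
  (* 0 < sigma^2 = E ||y_1 - y||^2 < oo *)
  (0 < \int[P]_w (`|ys 0%N w - y| ^+ 2)%:E)%E ->
  (\int[P]_w (`|ys 0%N w - y| ^+ 2)%:E < +oo)%E ->
  (* step size *)
  0 < gamma -> gamma * opnorm A ^+ 2 < 4 * c0 ->
  (* the iteration, with ybar^(n) = (1/n) sum_{i<n} y_i *)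
  (forall n w, (0 < n)%N -> lam n 0%N w = 0) ->
  (forall n t w, (0 < n)%N ->
     lam n t.+1 w = lam n t w
       - gamma *: (A (x n t w) - n%:R^-1 *: \sum_(i < n) ys i w)) ->
  (forall n t w, (0 < n)%N -> forall z,
     (Rf (x n t w) - (ip (lam n t w) (A (x n t w)))%:E
        <= Rf z - (ip (lam n t w) (A z))%:E)%E) ->
  (* t_n -> oo and t_n / n -> 0 *)
  (forall M : nat, \forall n \near \oo, (M <= tn n)%N) ->
  (fun n => (tn n)%:R / n%:R : R) @ \oo --> (0 : R) ->
  (fun n => (\int[P]_w bregman ip A Rf (lam n (tn n) w) xdag (x n (tn n) w))%E)
     @ \oo --> (0 : \bar R)
  /\
  (fun n => (\int[P]_w (`|x n (tn n) w - xdag| ^+ 2)%:E)%E) @ \oo --> (0 : \bar R).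
Proof.
move=> ipP A_bounded Rf0 Rf_proper Rf_lsc c0_gt0 Rf_convex [z0 [Az0 Dz0]] Axdag xdag_min.
move=> ys_borel ys_strong ys_indep ys_id ys_int ys_mean _ ys_var gamma0 gamma_small.
move=> lam0 lamS x_min tn_oo tn_n.
pose D := dom Rf; pose r z := fine (Rf z).
have rK z : D z -> Rf z = (r z)%:E.
  by move=> Dz; rewrite fineK// ge0_fin_numE.
have Dxdag : D xdag by exact: le_lt_trans (xdag_min _ Az0) Dz0.
have r0 z : D z -> 0 <= r z by move=> _; exact: fine_ge0.
have r_convex u v (s : R) : D u -> D v -> 0 <= s <= 1 ->
    D (s *: u + (1 - s) *: v) /\
    r (s *: u + (1 - s) *: v) + c0 * s * (1 - s) * `|u - v| ^+ 2
      <= s * r u + (1 - s) * r v.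
  move=> Du Dv s01; have := Rf_convex u v s Du Dv s01.
  rewrite (rK _ Du) (rK _ Dv) -!EFinM -EFinD => h.
  have Dm : D (s *: u + (1 - s) *: v).
    rewrite /D /dom /=; move: h (Rf0 (s *: u + (1 - s) *: v)).
    by case: (Rf _) => //= a; rewrite ltry.
  by split => //; rewrite -lee_fin EFinD -(rK _ Dm).
have r_lsc (u : nat -> X) v (a : R) : u @ \oo --> v -> (forall l, D (u l)) ->
    (\forall l \near \oo, r (u l) <= a) -> D v /\ r v <= a.
  move=> uv Du ra.
  have Rv : (Rf v <= a%:E)%E.
    apply: (lower_semicontinuous_seq _ _ _ _ _ _ Rf_lsc uv).
    by apply: filterS ra => l; rewrite (rK _ (Du l)) lee_fin.
  have Dv : D v by exact: le_lt_trans Rv (ltry _).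
  by split => //; rewrite -lee_fin -rK.
have r_xdag z : D z -> A z = y -> r xdag <= r z.
  by move=> Dz Az; rewrite -lee_fin -!rK//; exact: xdag_min.
(* Comparison with [xdag] bounds the minimal value by a finite one. *)
have Dx n t w : (0 < n)%N -> D (x n t w).
  move=> n0; have := x_min n t w n0 xdag; rewrite (rK _ Dxdag) -EFinB.
  by rewrite /D /dom /=; move: (Rf0 (x n t w)); case: (Rf _) => //= a; rewrite ltry.
have rx_min n t w z : (0 < n)%N -> D z ->
    r (x n t w) - ip (lam n t w) (A (x n t w)) <= r z - ip (lam n t w) (A z).
  move=> n0 Dz; have := x_min n t w n0 z.
  by rewrite (rK _ Dz) (rK _ (Dx n t w n0)) -!EFinB lee_fin.
pose ebar n w := n%:R^-1 *: \sum_(i < n) ys i w - y.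
pose C := gamma ^+ 2 / (gamma * (1 - gamma * opnorm A ^+ 2 / (4 * c0))).
have C0 : 0 < C.
  rewrite divr_gt0 ?exprn_gt0// mulr_gt0// subr_gt0 ltr_pdivrMr ?mul1r//.
  by rewrite mulr_gt0.
(* Since [A xdag = y], the Bregman distance is the dual objective at the current multiplier. *)
have bregE n w : (0 < n)%N -> bregman ip A Rf (lam n (tn n) w) xdag (x n (tn n) w) =
    (r xdag - r (x n (tn n) w) + ip (lam n (tn n) w) (A (x n (tn n) w) - y))%:E.
  move=> n0; rewrite /bregman (rK _ Dxdag) (rK _ (Dx _ _ _ n0)) -!EFinB.
  by congr _%:E; rewrite linearB Axdag !(ipBr ipP); ring.
have breg_ge n w : (0 < n)%N ->
    ((c0 * `|x n (tn n) w - xdag| ^+ 2)%:E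
      <= bregman ip A Rf (lam n (tn n) w) xdag (x n (tn n) w))%E.
  move=> n0; rewrite bregE// lee_fin.
  have := linear_tilt_min_growth ipP r_convex _ _ (Dx n (tn n) w n0)
    (fun z => rx_min n (tn n) w z n0) _ Dxdag.
  by rewrite Axdag distrC (ipBr ipP) => ?; lra.
pose s2 := fine (\int[P]_w (`|ys 0%N w - y| ^+ 2)%:E)%E.
have s2E : (\int[P]_w (`|ys 0%N w - y| ^+ 2)%:E = s2%:E)%E.
  by rewrite fineK// ge0_fin_numE// integral_ge0// => w _; rewrite lee_fin exprn_ge0.
have s20 : 0 <= s2 by apply: fine_ge0; apply: integral_ge0 => w _; rewrite lee_fin exprn_ge0.
(* The dual point [lb] depends on [e] only and is fixed before [n]. The coefficients do not depend
   on [w], so the majorant has a known integral even if the iterates are not measurable. *)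
have bound e : 0 < e -> \forall n \near \oo, (0 < n)%N /\
    exists a b : R, [/\ 0 <= a, 0 <= b,
      forall w, (bregman ip A Rf (lam n (tn n) w) xdag (x n (tn n) w)
        <= (a + b * `|ebar n w| ^+ 2)%:E)%E
      & a + b * (n%:R^-1 * s2) <= e].
  move=> e0; have e2 : 0 < e / 2 by lra.
  have [lb lbP] := strong_duality ipP A_bounded c0_gt0 r0 r_convex r_lsc
    y (r xdag) (ex_intro _ _ Dxdag) r_xdag _ e2.
  pose K := (1 + C) * `|lb| ^+ 2 + C * `|r xdag|.
  have K0 : 0 <= K.
    have C0' := ltW C0.
    apply: addr_ge0; apply: mulr_ge0; rewrite ?exprn_ge0//.
    by rewrite (le_trans C0')// lerDr.
  have small := error_bound_small _ tn (2 * gamma) C K s2 (e / 2)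
    (mulr_gt0 (ltr0Sn _ 1) gamma0) C0 K0 s20 e2 tn_oo tn_n.
  near=> n.
  have n0 : (0 < n)%N by near: n; exists 1%N.
  have small_n : K / (2 * gamma * (tn n)%:R + C) +
      ((2 * gamma * (tn n)%:R + C) / 4 + 1) * (n%:R^-1 * s2) <= e / 2.
    by near: n; exact: small.
  split=> //.
  pose S := 2 * gamma * (tn n)%:R + C.
  have S0 : 0 < S by rewrite ltr_wpDl// !mulr_ge0// ltW.
  exists (e / 2 + K / S), (S / 4 + 1); split.
  - by rewrite addr_ge0 ?divr_ge0// ltW.
  - by rewrite addr_ge0// divr_ge0// ltW.
  - move=> w; rewrite bregE// lee_fin.
    apply: (dual_gradient_descent_bound ipP A_bounded c0_gt0 r0 r_convex
      (fun t => Dx n t w n0) (lam0 n w n0) _ (fun t z => rx_min n t w z n0)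
      gamma0 gamma_small lb (e / 2) (tn n) e2 lbP) => t.
    by rewrite lamS// /ebar opprB addrA subrK.
  - by move: small_n; rewrite -/S; lra.
have intb n a b : (0 < n)%N -> 0 <= a -> 0 <= b ->
    (\int[P]_w (a + b * `|ebar n w| ^+ 2)%:E = (a + b * (n%:R^-1 * s2))%:E)%E.
  move=> n0 a0 b0.
  have [i1 z1] := sample_mean_variance ipP ys_borel ys_strong ys_indep ys_id
    ys_int ys_mean ys_var n n0.
  have ia : P.-integrable setT (EFin \o cst a) by exact: finite_measure_integrable_cst.
  have ib := integrableZl measurableT b i1.
  under eq_integral do rewrite EFinD EFinM.
  rewrite (integralD measurableT ia ib) integralZl// z1 s2E.
  by rewrite /= integral_cst//= probability_setT mule1.
have breg_ge0 n w : (0 < n)%N ->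
    (0 <= bregman ip A Rf (lam n (tn n) w) xdag (x n (tn n) w))%E.
  move=> n0; rewrite (le_trans _ (breg_ge n w n0))// lee_fin mulr_ge0 ?exprn_ge0//.
  exact: ltW.
split; apply: ge0_cvge0.
- by exists 1%N => // n n0; apply: integral_ge0 => w _; exact: breg_ge0.
- move=> e e0; have := bound e e0; apply: filterS => n [n0 [a [b [a0 b0 le_ab ab_e]]]].
  rewrite (@le_trans _ _ (a + b * (n%:R^-1 * s2))%:E) ?lee_fin// -intb//.
  by apply: ge0_le_integral_nonmeasurable => // w; exact: breg_ge0.
- by near=> n; apply: integral_ge0 => w _; rewrite lee_fin exprn_ge0.
(* The squared error is at most the Bregman distance divided by [c0], so the bound is used at level
   [c0 * e]. *)
move=> e e0; have c0e : 0 < c0 * e by rewrite mulr_gt0.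
have := bound _ c0e; apply: filterS => n [n0 [a [b [a0 b0 le_ab ab_e]]]].
have ci : 0 <= c0^-1 by rewrite invr_ge0 ltW.
rewrite (@le_trans _ _ (c0^-1 * a + c0^-1 * b * (n%:R^-1 * s2))%:E)//.
  rewrite -intb ?mulr_ge0//; apply: ge0_le_integral_nonmeasurable => w.
    by rewrite lee_fin exprn_ge0.
  have := le_trans (breg_ge n w n0) (le_ab w).
  by rewrite !lee_fin -mulrA -mulrDr ler_pdivlMl.
by rewrite lee_fin -mulrA -mulrDr ler_pdivrMl.
Unshelve. all: by end_near. Qed.
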